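(* Let $x_1,x_2,\tilde y_1,y_2,u_1,u_2,\tilde v_1,v_2,w_{\rm e},w_{\rm o},z_{\rm e},z_{\rm o}$ be commuting indeterminates and for $n\ge0$ let \[ \widetilde{P}_n=\sum_{\sigma\in\mathfrak{D}_{2n}}x_1^{\mathrm{eareccpeak}}x_2^{\mathrm{eareccdfall}}\tilde y_1^{\mathrm{minval}}y_2^{\mathrm{ereccdrise}}u_1^{\mathrm{nrcpeak}}u_2^{\mathrm{nrcdfall}}\tilde v_1^{\mathrm{nminval}}v_2^{\mathrm{nrcdrise}}w_{\rm e}^{\mathrm{evennrfix}}w_{\rm o}^{\mathrm{oddnrfix}}z_{\rm e}^{\mathrm{evenrar}}z_{\rm o}^{\mathrm{oddrar}}. \] Then \[ \sum_{n\ge0}\widetilde{P}_nt^n=\cfrac{1}{1-\delta_1t-\cfrac{\alpha_1t}{1-\delta_2t-\cfrac{\alpha_2t}{1-\cdots}}} \] as formal power series in $t$, where for $k\ge1$: $\alpha_{2k-1}=[x_1+(k-1)u_1][\tilde y_1+(k-1)\tilde v_1]$, $\alpha_{2k}=[x_2+(k-1)u_2+w_{\rm e}][y_2+(k-1)v_2+w_{\rm o}]$, $\delta_1=z_{\rm e}z_{\rm o}$, $\delta_n=0$ for $n\ge2$.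
   Context: A D-permutation of $[2n]$: $\sigma(2k-1)\ge2k-1$ and $\sigma(2k)\le2k$ for all $k$; $\mathfrak{D}_{2n}$ is their set. Cycle peak: $\sigma^{-1}(i)<i>\sigma(i)$; cycle valley: $\sigma^{-1}(i)>i<\sigma(i)$; cycle double rise: $\sigma^{-1}(i)<i<\sigma(i)$; cycle double fall: $\sigma^{-1}(i)>i>\sigma(i)$. Record: $\sigma(j)<\sigma(i)$ for all $j<i$; antirecord: $\sigma(j)>\sigma(i)$ for all $j>i$; exclusive record/antirecord = one but not the other; record-antirecord = both. $\mathrm{eareccpeak},\mathrm{eareccdfall}$ count cycle peaks, double falls that are exclusive antirecords; $\mathrm{ereccdrise}$ counts cycle double rises that are exclusive records; $\mathrm{nrcpeak},\mathrm{nrcdfall},\mathrm{nrcdrise}$ count cycle peaks, double falls, double rises that are neither records nor antirecords; $\mathrm{minval}$ counts cycle valleys that are the minimum element of their cycle and $\mathrm{nminval}$ counts the other cycle valleys; $\mathrm{evennrfix}$/$\mathrm{oddnrfix}$ count even/odd fixed points that are neither records nor antirecords; $\mathrm{evenrar}$/$\mathrm{oddrar}$ count even/odd indices that are record-antirecords. *)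

(* Defs.v *)
From HB Require Import structures.
From mathcomp Require Import all_boot all_order all_algebra all_fingroup.
From mathcomp Require Import mpoly zify.

Set Implicit Arguments.
Unset Strict Implicit.
Unset Printing Implicit Defensive.

Import GRing.Theory.

(* The ordinal i : 'I_m stands for the element i.+1 of [m] = {1, ..., m}, so
   the parity of an index is that of i.+1. *)
Section Permutations.

Variables (m : nat) (s : {perm 'I_m}).
Implicit Types i j : 'I_m.

Definition odd_index i := odd i.+1.
Definition even_index i := ~~ odd i.+1.

Definition D_permutation :=
  [forall i : 'I_m, if odd_index i then i <= s i else s i <= i].

Definition cpeak i := ((s^-1)%g i < i) && (s i < i).
Definition cvalley i := (i < (s^-1)%g i) && (i < s i).
Definition cdrise i := ((s^-1)%g i < i) && (i < s i).
Definition cdfall i := (i < (s^-1)%g i) && (s i < i).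
Definition fixpt i := s i == i.

Definition record i := [forall j : 'I_m, (j < i) ==> (s j < s i)].
Definition antirecord i := [forall j : 'I_m, (i < j) ==> (s i < s j)].
Definition erec i := record i && ~~ antirecord i.
Definition earec i := antirecord i && ~~ record i.
Definition rar i := record i && antirecord i.
Definition nrar i := ~~ record i && ~~ antirecord i.

Definition cycle_min i := [forall j : 'I_m, (j \in porbit s i) ==> (i <= j)].

Definition eareccpeak := #|[set i | earec i && cpeak i]|.
Definition eareccdfall := #|[set i | earec i && cdfall i]|.
Definition ereccdrise := #|[set i | erec i && cdrise i]|.
Definition nrcpeak := #|[set i | nrar i && cpeak i]|.
Definition nrcdfall := #|[set i | nrar i && cdfall i]|.
Definition nrcdrise := #|[set i | nrar i && cdrise i]|.
Definition minval := #|[set i | cvalley i && cycle_min i]|.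
Definition nminval := #|[set i | cvalley i && ~~ cycle_min i]|.
Definition evennrfix := #|[set i | [&& even_index i, fixpt i & nrar i]]|.
Definition oddnrfix := #|[set i | [&& odd_index i, fixpt i & nrar i]]|.
Definition evenrar := #|[set i | even_index i && rar i]|.
Definition oddrar := #|[set i | odd_index i && rar i]|.

End Permutations.

Local Open Scope ring_scope.

Definition indet (k : nat) : {mpoly int[12]} := 'X_(inord k).

(* y1 and v1 are the variables carrying a tilde. *)
Definition x1 := indet 0.
Definition x2 := indet 1.
Definition y1 := indet 2.
Definition y2 := indet 3.
Definition u1 := indet 4.
Definition u2 := indet 5.
Definition v1 := indet 6.
Definition v2 := indet 7.
Definition we := indet 8.
Definition wo := indet 9.
Definition ze := indet 10.
Definition zo := indet 11.

Definition Ptilde (n : nat) : {mpoly int[12]} :=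
  \sum_(s : {perm 'I_(2 * n)} | D_permutation s)
    x1 ^+ eareccpeak s * x2 ^+ eareccdfall s *
    y1 ^+ minval s * y2 ^+ ereccdrise s *
    u1 ^+ nrcpeak s * u2 ^+ nrcdfall s *
    v1 ^+ nminval s * v2 ^+ nrcdrise s *
    we ^+ evennrfix s * wo ^+ oddnrfix s *
    ze ^+ evenrar s * zo ^+ oddrar s.

(* A formal power series in t over R is given by its coefficient function. *)
Section FormalPowerSeries.

Variable R : comNzRingType.
Implicit Types f g : nat -> R.

Definition fps_one : nat -> R := fun n => (n == 0%N)%:R.
Definition fps_mul f g : nat -> R := fun n => \sum_(i < n.+1) f i * g (n - i)%N.
Definition fps_exp f k : nat -> R := iter k (fps_mul f) fps_one.

(* 1 / (1 - g) for g with zero constant term, by the geometric series: the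
   powers g ^ k with k > n do not contribute to the coefficient of t ^ n. *)
Definition fps_geom g : nat -> R := fun n => \sum_(k < n.+1) fps_exp g k n.

(* The series a t + b t f. *)
Definition fps_level (a b : R) f : nat -> R :=
  fun n => if n is n'.+1 then a * fps_one n' + b * f n' else 0.

(* The finite fraction with the N levels k, k + 1, ..., k + N - 1:
     1 / (1 - delta_k t - alpha_k t / (1 - delta_(k+1) t - ... )),
   cut by replacing the tail at level k + N by 0. *)
Fixpoint T_convergent (alpha delta : nat -> R) (N k : nat) : nat -> R :=
  if N is N'.+1 then
    fps_geom (fps_level (delta k) (alpha k) (T_convergent alpha delta N' k.+1))
  else fun=> 0.

(* The infinite fraction with levels 1, 2, ... equals f, as the limit of its
   convergents in the t-adic topology. *)
Definition is_T_fraction (alpha delta f : nat -> R) :=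
  forall n, exists N0, forall N,
    (N0 <= N)%N -> T_convergent alpha delta N 1 n = f n.

Lemma fps_mul_poly N f g n : (n < N)%N ->
  fps_mul f g n = ((\poly_(i < N) f i) * (\poly_(i < N) g i))`_n.
Proof.
move=> nN; rewrite coefM; apply: eq_bigr => i _; rewrite !coef_poly.
by rewrite (leq_ltn_trans (leq_subr _ _) nN) (leq_ltn_trans _ nN) // -ltnS.
Qed.

Lemma fps_exp_poly N f k n : (n < N)%N ->
  fps_exp f k n = ((\poly_(i < N) f i) ^+ k)`_n.
Proof.
elim: k n => [|k IH] n nN; first by rewrite expr0 coef1.
rewrite exprS coefM /=; apply: eq_bigr => i _; rewrite coef_poly.
by rewrite IH ?(leq_ltn_trans (leq_subr _ _) nN) // (leq_ltn_trans _ nN) // -ltnS.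
Qed.

Lemma fps_geomP g : g 0%N = 0 ->
  fps_mul (fun n => fps_one n - g n) (fps_geom g) =1 fps_one.
Proof.
move=> g0 n; set N := n.+1; set p := \poly_(i < N) g i.
have pow0 k i : (i < k)%N -> (p ^+ k)`_i = 0.
  elim: k i => // k IH i ik; rewrite exprS coefM big1 // => j _.
  case: j => [[|j] /= hj]; first by rewrite coef_poly /= g0 mul0r.
  by rewrite IH ?mulr0 //; lia.
have geomE i : (i < N)%N -> fps_geom g i = (\sum_(k < N) p ^+ k)`_i.
  move=> iN; rewrite coef_sum /fps_geom.
  rewrite -(big_mkord xpredT (fun k => fps_exp g k i)).
  rewrite -(big_mkord xpredT (fun k => (p ^+ k)`_i)).
  rewrite [RHS](@big_cat_nat _ _ _ i.+1) //=.
  have -> : \sum_(i.+1 <= k < N) (p ^+ k)`_i = 0.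
    by rewrite big_nat_cond big1 // => k /andP[/andP[ik _] _]; rewrite pow0.
  rewrite addr0 big_nat [RHS]big_nat; apply: eq_bigr => k _.
  by rewrite (fps_exp_poly g k iN).
transitivity (((1 - p) * \sum_(k < N) p ^+ k)`_n).
  rewrite coefM; apply: eq_bigr => i _; rewrite coefB coef1 coef_poly.
  by rewrite ltn_ord -geomE // ltnS leq_subr.
by rewrite -[1 - p]opprB mulNr -subrX1 opprB coefB coef1 pow0 ?subr0.
Qed.

End FormalPowerSeries.

(* Main.v *)
Require Import Defs.
From mathcomp Require Import all_boot all_order all_algebra all_fingroup.
From mathcomp Require Import mpoly.
From mathcomp Require Import zify ring.

(* Record at each index [k] whether [k] is fixed, and if not, whether [k] is the
   image of a larger or of a smaller index.  A D-permutation of a given shape is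
   then built by choosing its values one at a time, first at the even indices in
   increasing order, then at the odd indices in decreasing order.  At each index
   the number of available values is the height of a lattice path determined by
   the shape.  At an even index the smallest available value gives an
   antirecord; at a cycle double rise the largest one gives a record; at a cycle
   valley exactly one available value closes a cycle, and that is the case where
   the valley is the minimum of its cycle, because all larger indices and all
   even indices already have their images.  Hence the weight of a shape is a
   product of affine functions of the heights, and [Ptilde n] is a weighted sum
   over lattice paths with [2 * n] steps.  The T-fraction is identified with this
   sum through the products of its first tails, which satisfy the same recurrence
   as the weighted paths that end at a given height. *)

Set Implicit Arguments.
Unset Strict Implicit.
Unset Printing Implicit Defensive.

Import GRing.Theory.
Local Open Scope ring_scope.

(** * Formal power series *)

Section FpsAlgebra.

Variable R : comNzRingType.
Implicit Types f g h : nat -> R.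

(** The coefficient at [n] sees only truncations, so associativity is inherited from polynomials. *)
Lemma fps_mulA f g h : fps_mul f (fps_mul g h) =1 fps_mul (fps_mul f g) h.
Proof.
move=> n; rewrite (fps_mul_poly f _ (ltnSn n)) (fps_mul_poly _ h (ltnSn n)).
set p := \poly_(i < _) f i; pose q := \poly_(i < n.+1) g i.
set r := \poly_(i < _) h i.
transitivity ((p * (q * r))`_n).
  rewrite !coefM; apply: eq_bigr => i _; congr (_ * _).
  by rewrite coef_poly ltnS leq_subr -fps_mul_poly ?ltnS ?leq_subr.
rewrite mulrA !coefM; apply: eq_bigr => i _; congr (_ * _).
by rewrite coef_poly ltn_ord -fps_mul_poly.
Qed.

Lemma fps_mul1 f : fps_mul (@fps_one R) f =1 f.
Proof.
move=> n; rewrite /fps_mul big_ord_recl /fps_one /= mul1r subn0 big1 ?addr0 //.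
by move=> i _; rewrite /= mul0r.
Qed.

Lemma fps_mul_level a b f g n :
  fps_mul (fps_level a b f) g n.+1 = a * g n + b * fps_mul f g n.
Proof.
rewrite /fps_mul big_ord_recl /= mul0r add0r.
under eq_bigr do rewrite /= add0n subSS mulrDl -!mulrA.
rewrite big_split -!mulr_sumr /=; congr (_ * _ + _).
by rewrite -[RHS](fps_mul1 g).
Qed.

End FpsAlgebra.

Section TailProducts.

Variables (R : comNzRingType) (alpha delta : nat -> R) (N : nat).

(* The product of the tails at levels 1, ..., k: up to the weights of the
   unmatched steps, the generating function of the Schröder paths that end at
   height k. *)
Fixpoint tail_prod (k : nat) : nat -> R :=
  if k is k'.+1 then
    fps_mul (T_convergent alpha delta (N - k') k'.+1) (tail_prod k')
  else @fps_one R.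

(** The tail at level [k.+1] is the inverse of one minus the level series, so multiplying
    [tail_prod k.+1] by that difference removes its last factor. *)
Lemma tail_prodB k n : (k < N)%N ->
  tail_prod k n = tail_prod k.+1 n -
    fps_mul (fps_level (delta k.+1) (alpha k.+1)
               (T_convergent alpha delta (N - k.+1) k.+2)) (tail_prod k.+1) n.
Proof.
move=> kN; rewrite /= -/(tail_prod k).
have -> : (N - k = (N - k.+1).+1)%N by lia.
rewrite /= -[LHS]fps_mul1; set g := fps_level _ _ _.
have eq1 : fps_mul (@fps_one R) (tail_prod k) n =
    fps_mul (fps_mul (fun n => fps_one R n - g n) (fps_geom g)) (tail_prod k) n.
  by apply: eq_bigr => i _; rewrite fps_geomP.
rewrite {}eq1 -fps_mulA -[X in _ = X - _]fps_mul1 -sumrB.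
by apply: eq_bigr => i _; rewrite mulrBl.
Qed.

Lemma tail_prod0 k : (k <= N)%N -> tail_prod k 0 = 1.
Proof.
elim: k => // k IH kN; rewrite -(IH (ltnW kN)) (tail_prodB _ kN).
by rewrite [X in _ - X]big_ord_recl big_ord0 /= mul0r addr0 subr0.
Qed.

(** Decomposition by the last step: a rise, a level step or a fall. Only level steps and falls carry
    a factor [t], hence the degree [n.+1] in the first term. *)
Lemma tail_prodS k n : (k < N)%N ->
  tail_prod k.+1 n.+1 = tail_prod k n.+1 + delta k.+1 * tail_prod k.+1 n
                        + alpha k.+1 * tail_prod k.+2 n.
Proof. by move=> kN; rewrite (tail_prodB _ kN) fps_mul_level -addrA subrK. Qed.

Lemma tail_prod1 n : (0 < N)%N ->
  tail_prod 1 n = T_convergent alpha delta N 1 n.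
Proof.
move=> N0; rewrite /= subn0 /fps_mul big_ord_recr /= subnn mulr1 big1 ?add0r //.
by move=> i _; rewrite /fps_one subn_eq0 leqNgt ltn_ord mulr0.
Qed.

End TailProducts.
Arguments tail_prod : simpl never.

(** * Sequential choices *)

Section Update.

Variable I : finType.
Implicit Types (f g : {ffun I -> I}) (i j x : I).

Definition upd f i x : {ffun I -> I} := [ffun j => if j == i then x else f j].

Lemma upd_id f i : upd f i (f i) = f.
Proof. by apply/ffunP => j; rewrite ffunE; case: eqP => [->|]. Qed.

Lemma upd_upd f i x y : upd (upd f i x) i y = upd f i y.
Proof. by apply/ffunP => j; rewrite !ffunE; case: eqP. Qed.

Lemma updE f i x : upd f i x i = x.
Proof. by rewrite ffunE eqxx. Qed.

Lemma updN f i x j : j != i -> upd f i x j = f j.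
Proof. by rewrite ffunE => /negbTE ->. Qed.

End Update.

(* The values are chosen one position at a time, in the order of increasing
   [rk]; the total weight of the choices at each position does not depend on
   the earlier choices. *)
Lemma sum_sequential_choices (R : comNzRingType) (I : finType) (rk : I -> nat)
    (w : I -> {ffun I -> I} -> R) (c : I -> R) :
  injective rk ->
  (forall i (f g : {ffun I -> I}), (forall j, (rk j <= rk i)%N -> f j = g j) ->
     w i f = w i g) ->
  (forall i f, (forall j, (rk j < rk i)%N -> w j f != 0) ->
     \sum_x w i (upd f i x) = c i) ->
  \sum_f \prod_i w i f = \prod_i c i.
Proof.
move=> rk_inj w_ext w_sum.
(* Positions of rank at least [k] are pinned to a default value, so that each partial choice is
   represented by exactly one function. *)
pose fixes k (f : {ffun I -> I}) := [forall j, (k <= rk j)%N ==> (f j == j)].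
have main k : \sum_(f | fixes k f) \prod_(i | (rk i < k)%N) w i f
              = \prod_(i | (rk i < k)%N) c i.
  elim: k => [|k IH].
    rewrite [RHS]big1 // (big_pred1 [ffun j => j]) => [|f]; first by rewrite big1.
    apply/forallP/eqP => /= [fK|-> j]; last by rewrite ffunE.
    by apply/ffunP => j; rewrite ffunE; apply/eqP/fK.
  case: (pickP (fun i => rk i == k)) => [i /eqP rki | no_k]; last first.
    have ltE j : (rk j < k.+1)%N = (rk j < k)%N.
      by rewrite ltnS leq_eqVlt no_k.
    under [RHS]eq_bigl do rewrite ltE; rewrite -IH.
    apply: eq_big => [f|f _]; last by apply: eq_bigl.
    by apply: eq_forallb => j; rewrite [in RHS]leq_eqVlt [k == _]eq_sym no_k.
  rewrite (bigD1 i) ?rki //= (eq_bigl (fun j => (rk j < k)%N)); last first.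
    move=> j; rewrite ltnS leq_eqVlt -rki (inj_eq rk_inj).
    by case: eqVneq => [->|_]; rewrite ?ltnn ?andbF ?andbT.
  (* Functions are grouped by resetting the value at [i] to its default; the group of [g] consists
     of the functions [upd g i x]. *)
  rewrite -IH (partition_big (fun f => upd f i i) (fixes k)) /=; last first.
    move=> f /forallP fK; apply/forallP => j; apply/implyP => kj.
    rewrite ffunE; case: (eqVneq j i) => [->|ji]; first exact: eqxx.
    apply: (implyP (fK j)).
    by rewrite ltn_neqAle kj -rki (inj_eq rk_inj) eq_sym ji.
  rewrite mulr_sumr; apply: eq_bigr => g gK.
  have gi : g i = i by apply/eqP; move/forallP/(_ i): gK; rewrite rki leqnn.
  have gE : upd g i i = g by rewrite -{2}gi upd_id.
  rewrite (reindex_onto (upd g i) (fun f => f i)); last first.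
    by move=> f /andP[_ /eqP <-]; rewrite upd_upd upd_id.
  rewrite (eq_bigl xpredT) => [|x]; last first.
    rewrite upd_upd updE gE !eqxx !andbT; apply/forallP => j.
    apply/implyP => kj; rewrite updN ?(implyP (forallP gK j)) ?(ltnW kj) //.
    by apply: contraTneq kj => ->; rewrite rki ltnn.
  under eq_bigr => x _.
    rewrite (bigD1 i) ?rki //= (eq_bigl (fun j => (rk j < k)%N)); last first.
      move=> j; rewrite ltnS leq_eqVlt -rki (inj_eq rk_inj).
      by case: eqVneq => [->|_]; rewrite ?ltnn ?andbF ?andbT.
    rewrite (eq_bigr (fun j => w j g)); last first.
      move=> j jk; apply: w_ext => l lj; rewrite updN //.
      by apply: contraTneq (leq_ltn_trans lj jk) => ->; rewrite rki ltnn.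
    over.
  rewrite -mulr_suml.
  (* [w_sum] requires nonzero earlier weights; if one of them vanishes, the product over the earlier
     positions makes both sides zero. *)
  have [/forallP wn0|] := boolP [forall j, (rk j < k)%N ==> (w j g != 0)].
    by rewrite w_sum // => j; rewrite rki; apply/implyP.
  rewrite negb_forall => /existsP[j]; rewrite negb_imply => /andP[jk].
  rewrite negbK => /eqP wj0.
  by rewrite (_ : \prod_(i | _) _ = 0) ?mulr0 // (bigD1 j) //= wj0 mul0r.
have lt_rk i : (rk i < (\max_j rk j).+1)%N by rewrite ltnS leq_bigmax.
have fixesT f : fixes (\max_j rk j).+1 f.
  by apply/forallP => j; rewrite leqNgt lt_rk.
transitivity (\sum_(f | fixes (\max_j rk j).+1 f)
                \prod_(i | (rk i < (\max_j rk j).+1)%N) w i f).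
  by apply: eq_big => [f|f _]; [rewrite fixesT | apply: eq_bigl => i; rewrite lt_rk].
by rewrite main; apply: eq_bigl => i; rewrite lt_rk.
Qed.

(** The total weight of [h] choices when exactly one of them has weight [a] and the others have
    weight [b]; no choice gives the empty sum. *)
Definition lin (R : pzRingType) (a b : R) (h : nat) : R :=
  if h is h'.+1 then a + h'%:R * b else 0.

Lemma sum_one_special (R : pzRingType) (T : finType) (S : {set T}) (P : pred T)
    (a b : R) :
  #|[set x in S | P x]| = (S != set0) ->
  \sum_(x in S) (if P x then a else b) = lin a b #|S|.
Proof.
case: (eqVneq S set0) => [->|_ /= card1]; first by rewrite big_set0 cards0.
rewrite (bigID P) /= (eq_bigr (fun=> a)) => [|x /andP[_ ->] //].
rewrite [X in _ + X](eq_bigr (fun=> b)) => [|x /andP[_ /negbTE ->] //].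
rewrite !sumr_const.
have card_special : #|[pred x | (x \in S) && P x]| = 1%N.
  by rewrite -card1; apply: eq_card => x; rewrite !inE.
have := cardID P S; rewrite (@eq_card _ [predI S & P] [pred x | (x \in S) && P x]) //.
rewrite card_special (@eq_card _ [predD S & P] [pred x | (x \in S) && ~~ P x]); last first.
  by move=> x; rewrite !inE andbC.
move=> <-; rewrite /= mulr1n; congr (_ + _).
by rewrite mulr_natl; congr (_ *+ _); apply: eq_card.
Qed.

(** * Closing a cycle *)

Section ClosingChoice.

Variables (T : finType) (A : {set T}) (i : T) (f : {ffun T -> T}).
Hypothesis iA : i \notin A.
Hypothesis f_inj : {in A &, injective f}.

Let reach x k := iter k f x = i /\ forall l, (l < k)%N -> iter l f x \in A.

(** The iterates before step [k] are distinct: a repetition would let the path reach [i] strictly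
    before step [k], while it must still be in [A]. *)
Let reach_bound x k : reach x k -> (k <= #|T|)%N.
Proof.
move=> [xk xA]; rewrite -[k]card_ord.
suff lt_neq (a b : 'I_k) : (a < b)%N -> iter a f x <> iter b f x.
  apply: (@leq_card _ _ (fun l : 'I_k => iter l f x)) => a b eq_ab.
  by apply: val_inj; case: (ltngtP a b) => // /lt_neq; rewrite eq_ab.
move=> ab eq_ab; have/xA : (k - b + a < k)%N by have := ltn_ord b; lia.
by rewrite iterD eq_ab -iterD subnK ?xk ?(negbTE iA) // ltnW.
Qed.

(** By injectivity the two paths agree when read backwards from [i]. If one were longer, the start
    of the shorter one would have a preimage in [A]. *)
Let reach_unique x y k l : x \notin f @: A -> y \notin f @: A ->
  reach x k -> reach y l -> x = y.
Proof.
wlog kl : x y k l / (k <= l)%N.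
  move=> H xA yA rx ry; case: (leqP k l) => [kl|/ltnW lk]; first exact: (H x y k l).
  by apply/esym; apply: (H y x l k).
move=> xA _ [xk xin] [yl yin].
have back j : (j <= k)%N -> iter (k - j) f x = iter (l - j) f y.
  elim: j => [|j IH] jk; first by rewrite !subn0 xk yl.
  apply: f_inj; [by apply: xin; lia | by apply: yin; lia |].
  by rewrite -!iterS -!subSn ?IH ?subSS //; lia.
have := back k (leqnn k); rewrite subnn /=.
case lk: (l - k)%N => [//|p] eq_x; case/negP: xA.
by rewrite eq_x iterS imset_f // yin //; lia.
Qed.

(** A longest path ending at [i] starts at a point without preimage in [A], since otherwise it could
    be extended backwards. *)
Let reach_exists : exists2 x, x \in (i |: A) :\: f @: A & exists k, reach x k.
Proof.
pose P k := [exists x, (iter k f x == i) && [forall l : 'I_k, iter l f x \in A]].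
have reachP k : reflect (exists x, reach x k) (P k).
  apply: (iffP existsP) => -[x].
    move=> /andP[/eqP xk /forallP xA]; exists x; split=> // l lk.
    exact: (xA (Ordinal lk)).
  by move=> [xk xA]; exists x; rewrite xk eqxx; apply/forallP => l; apply: xA.
have exP : exists k, P k by exists 0%N; apply/reachP; exists i; split.
have P_bound k : P k -> (k <= #|T|)%N by move=> /reachP[x /reach_bound].
have [K /reachP[x [xK xA]] Kmax] := ex_maxnP exP P_bound.
exists x; last by exists K.
rewrite in_setD; apply/andP; split.
  apply/imsetP => -[y yA eq_x]; suff/reachP/Kmax: exists x, reach x K.+1.
    by rewrite ltnn.
  exists y; split=> [|[|l] lK]; rewrite ?iterSr -?eq_x //.
  by apply: xA.
by rewrite !inE; case: K xK xA {Kmax} => [<-|K _ /(_ 0%N isT) ->]; rewrite ?eqxx ?orbT.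
Qed.

Let closes x := [forall j, fconnect (upd f i x) i j ==> (j \in i |: A)].

(** The new function sends [i] to [x] and then follows the path back to [i]. *)
Let reach_closes x k : reach x k -> closes x.
Proof.
move=> [xk xA]; apply/forallP => j; apply/implyP => /iter_findex <-.
suff [->|[l lk ->]] : iter (findex (upd f i x) i j) (upd f i x) i = i \/
    exists2 l, (l <= k)%N & iter (findex (upd f i x) i j) (upd f i x) i = iter l f x.
- by rewrite !inE eqxx.
- rewrite !inE; move: lk; rewrite leq_eqVlt => /orP[/eqP->|/xA ->].
    by rewrite xk eqxx.
  by rewrite orbT.
elim: (findex _ _ _) => [|n IH]; first by left.
rewrite iterS; case: (eqVneq (iter n (upd f i x) i) i) => [->|ni].
  by right; exists 0%N; rewrite ?updE.
case: IH => [eq_i|[l lk eq_l]]; first by rewrite eq_i eqxx in ni.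
right; exists l.+1; last by rewrite updN // eq_l.
by rewrite ltn_neqAle lk andbT; apply: contraNneq ni => eq_lk; rewrite eq_l eq_lk xk.
Qed.

(** If the orbit of [x] meets [i], its first visit ends the desired path. Otherwise the orbit stays
    in [A], where injectivity makes it a cycle through [x], giving [x] a preimage in [A]. *)
Let closes_reach x : x \notin f @: A -> closes x -> exists k, reach x k.
Proof.
set f' := upd f i x => xA /forallP cl.
have iter_in n : iter n f' x \in i |: A.
  have -> : iter n f' x = iter n.+1 f' i by rewrite iterSr updE.
  exact: (implyP (cl _) (fconnect_iter _ _ _)).
have iter_eq n : (forall l, (l < n)%N -> iter l f' x != i) ->
    iter n f' x = iter n f x.
  elim: n => // n IH Hn; rewrite !iterS updN ?Hn // IH // => l ln.
  by apply: Hn; apply: ltnW.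
have [xi|xi] := boolP (fconnect f' x i).
  have ex : exists k, iter k f' x == i by exists (findex f' x i); rewrite iter_findex.
  have [k /eqP xk kmin] := ex_minnP ex.
  have ne l : (l < k)%N -> iter l f' x != i.
    by move=> lk; apply/negP => /kmin; rewrite leqNgt lk.
  exists k; split=> [|l lk]; first by rewrite -iter_eq.
  have := iter_in l; rewrite !inE (negbTE (ne _ lk)) /= iter_eq // => j jl.
  by apply: ne; apply: ltn_trans lk.
have ne l : iter l f' x != i.
  by apply: contraNneq xi => <-; apply: fconnect_iter.
have itA l : iter l f x \in A.
  by have := iter_in l; rewrite !inE (negbTE (ne _)) /= iter_eq.
have back a b : iter (a + b) f x = iter a f x -> iter b f x = x.
  elim: a => // a IH eq_ab; apply: IH; apply: f_inj => //.
have /trajectP[a a_lt eq_a] := looping_order f x.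
case/negP: xA; have := back a (fingraph.order f x - a)%N.
rewrite subnKC ?(ltnW a_lt) // => /(_ eq_a).
case: (fingraph.order f x - a)%N (subn_gt0 a (fingraph.order f x)) => [|p _ <-].
  by rewrite ltnn a_lt.
by rewrite iterS imset_f.
Qed.

(* Among the edges from [i] to a point without a preimage in [A], exactly one
   closes a cycle through [i]: it points to the other end of the maximal path
   that ends at [i]. *)
Lemma card_closing_choices :
  #|[set x in (i |: A) :\: f @: A |
     [forall j, fconnect (upd f i x) i j ==> (j \in i |: A)]]| = 1%N.
Proof.
have [x xB [k rx]] := reach_exists.
apply/eqP/cards1P; exists x; apply/setP => y; rewrite in_set1 in_set.
apply/andP/eqP => [[yB cl]|->]; last by split=> //; apply: reach_closes rx.
have yA : y \notin f @: A by move: yB; rewrite in_setD => /andP[].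
have xA : x \notin f @: A by move: xB; rewrite in_setD => /andP[].
by have [l ry] := closes_reach yA cl; apply: reach_unique ry rx.
Qed.

End ClosingChoice.

(** * Shapes and available values *)

Lemma card_set_sum (T : finType) (P : pred T) :
  #|[set x | P x]| = (\sum_x P x)%N.
Proof.
by rewrite -sum1_card big_mkcond; apply: eq_bigr => x _; rewrite inE; case: (P x).
Qed.

Lemma card_least (m : nat) (S : {set 'I_m}) :
  #|[set x in S | [forall k in S, (x <= k)%N]]| = (S != set0).
Proof.
have [->|[x0 xS]] := set_0Vmem S.
  by rewrite eqxx; apply/eqP; rewrite cards_eq0; apply/eqP/setP => x; rewrite !inE.
have -> : S != set0 by apply/set0Pn; exists x0.
apply/eqP/cards1P; case: (arg_minnP (fun x : 'I_m => x : nat) xS) => x xin xmin.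
exists x; apply/setP => y; rewrite !inE; apply/andP/eqP => [[yS /forall_inP ymin]|->].
  by apply/val_inj/eqP; rewrite eqn_leq xmin // ymin.
by split=> //; apply/forall_inP.
Qed.

Lemma card_greatest (m : nat) (S : {set 'I_m}) :
  #|[set x in S | [forall k in S, (k <= x)%N]]| = (S != set0).
Proof.
have [->|[x0 xS]] := set_0Vmem S.
  by rewrite eqxx; apply/eqP; rewrite cards_eq0; apply/eqP/setP => x; rewrite !inE.
have -> : S != set0 by apply/set0Pn; exists x0.
apply/eqP/cards1P; case: (arg_maxnP (fun x : 'I_m => x : nat) xS) => x xin xmax.
exists x; apply/setP => y; rewrite !inE; apply/andP/eqP => [[yS /forall_inP ymax]|->].
  by apply/val_inj/eqP; rewrite eqn_leq ymax // andbT; apply: xmax.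
by split=> //; apply/forall_inP => k; apply: xmax.
Qed.

(* The shape of a permutation records [None] at a fixed point [k], and
   [Some b] at any other [k], where [b] tells whether [k] is the image of a
   larger index. *)
Section Shapes.

Variable m : nat.
Implicit Types (t : seq (option bool)) (f g : {ffun 'I_m -> 'I_m}) (i j k : 'I_m).

(* [dvals] and [dpos] collect the values and the positions, below [p], of the
   arcs [j |-> f j] with [f j < j]; [uvals] and [upos] those, above [p], of the
   arcs with [j < f j]. *)
Definition dvals t (p : nat) :=
  [set k : 'I_m | (k < p)%N && (nth None t k == Some true)].
Definition dpos t (p : nat) :=
  [set j : 'I_m | [&& (j < p)%N, even_index j & nth None t j != None]].
Definition uvals t (p : nat) :=
  [set k : 'I_m | (p < k)%N && (nth None t k == Some false)].
Definition upos t (p : nat) :=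
  [set j : 'I_m | [&& (p < j)%N, odd_index j & nth None t j != None]].

Definition davail t f i := dvals t i :\: f @: dpos t i.
Definition uavail t f i := uvals t i :\: f @: upos t i.

(** The height of a lattice path: cycle valleys are rises, cycle peaks are falls, and at a double
    fall the value gained and the position lost cancel. *)
Definition hgt t p := (#|dvals t p| - #|dpos t p|)%N.
Definition balanced t := #|dvals t m| == #|dpos t m|.

Definition admissible t f j :=
  if nth None t j == None then f j == j
  else if odd_index j then f j \in uavail t f j else f j \in davail t f j.

(** Only forward orbits are used, so this makes sense for functions not yet known to be
    permutations. *)
Definition cycle_least f i := [forall j, fconnect f i j ==> (i <= j)%N].

Lemma davail_ext t f g i :
  (forall j, (j < i)%N -> even_index j -> f j = g j) -> davail t f i = davail t g i.
Proof.
move=> fg; congr (_ :\: _); apply: eq_in_imset => j.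
by rewrite inE => /and3P[ji ev _]; apply: fg.
Qed.

Lemma uavail_ext t f g i :
  (forall j, (i < j)%N -> odd_index j -> f j = g j) -> uavail t f i = uavail t g i.
Proof.
move=> fg; congr (_ :\: _); apply: eq_in_imset => j.
by rewrite inE => /and3P[ji ev _]; apply: fg.
Qed.

(** Every non-fixed index above [i] occurs once as a value and once as a position, so the two kinds
    of arcs have opposite excesses there; balance relates this to the indices up to [i] included. *)
Lemma hgt_dual t i : balanced t -> (#|uvals t i| - #|upos t i| = hgt t i.+1)%N.
Proof.
move=> /eqP bal.
pose D' := [set k : 'I_m | (i < k)%N && (nth None t k == Some true)].
pose E' := [set j : 'I_m | [&& (i < j)%N, even_index j & nth None t j != None]].
have eqD : (#|dvals t m| = #|dvals t i.+1| + #|D'|)%N.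
  rewrite !card_set_sum -big_split; apply: eq_bigr => k _; rewrite ltn_ord ltnS.
  by case: ltngtP => _; case: eqP.
have eqE : (#|dpos t m| = #|dpos t i.+1| + #|E'|)%N.
  rewrite !card_set_sum -big_split; apply: eq_bigr => k _; rewrite ltn_ord ltnS.
  by case: ltngtP => _; case: (_ && _).
have eqU : (#|D'| + #|uvals t i| = #|E'| + #|upos t i|)%N.
  rewrite !card_set_sum -!big_split; apply: eq_bigr => k _.
  by rewrite /even_index /odd_index; case: (i < k)%N; case: (odd _); case: (nth _ _ _) => [[]|].
by rewrite /hgt; lia.
Qed.

Section Admissible.

Variables (t : seq (option bool)) (f : {ffun 'I_m -> 'I_m}).

Lemma admissible_fix j : admissible t f j -> nth None t j = None -> f j = j.
Proof. by rewrite /admissible => adm eqt; move: adm; rewrite eqt => /eqP. Qed.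

Lemma admissible_even j : admissible t f j -> even_index j -> nth None t j != None ->
  f j \in davail t f j.
Proof. by move=> adm ev /negbTE tj; move: adm; rewrite /admissible tj ifN. Qed.

Lemma admissible_odd j : admissible t f j -> odd_index j -> nth None t j != None ->
  f j \in uavail t f j.
Proof. by move=> adm od /negbTE tj; move: adm; rewrite /admissible tj od. Qed.

Lemma davailP k i : k \in davail t f i -> (k < i)%N /\ nth None t k = Some true.
Proof. by rewrite !inE => /and3P[_ ? /eqP]. Qed.

Lemma uavailP k i : k \in uavail t f i -> (i < k)%N /\ nth None t k = Some false.
Proof. by rewrite !inE => /and3P[_ ? /eqP]. Qed.

Lemma admissible_shape j : admissible t f j ->
  nth None t (f j) = if nth None t j == None then None else Some (even_index j).
Proof.
move=> adm; case: eqP => [tj|/eqP tj]; first by rewrite (admissible_fix adm tj).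
case: (boolP (even_index j)) => ev.
  by have /davailP[] := admissible_even adm ev tj.
by have /uavailP[] := admissible_odd adm (negbNE ev) tj.
Qed.

(** Equal images have the same shape entry, so both arguments are fixed or they have the same
    parity; in the latter case the one chosen later avoids the value of the other. *)
Lemma admissible_inj (D : {set 'I_m}) :
  {in D, forall j, admissible t f j} -> {in D &, injective f}.
Proof.
move=> adm j j' jD j'D eq_f.
have := admissible_shape (adm _ jD); have := admissible_shape (adm _ j'D).
rewrite -eq_f => ->; case: eqP => [tj'|/eqP tj']; case: eqP => [tj|/eqP tj] //.
  by move: eq_f; rewrite (admissible_fix (adm _ jD) tj) (admissible_fix (adm _ j'D) tj').
move=> [eq_ev]; apply/val_inj; move: eq_f.
wlog lt_jj' : j j' jD j'D tj tj' eq_ev / (j < j')%N.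
  move=> H eq_f; case: (ltngtP j j') => // lt_j; first exact: (H j j').
  exact/esym/(H j' j).
move=> eq_f; case: (boolP (even_index j)) => ev.
  have ev' : even_index j' by rewrite eq_ev.
  have := admissible_even (adm _ j'D) ev' tj'; rewrite in_setD => /andP[/negP[]].
  by rewrite -eq_f imset_f // inE lt_jj' ev.
have od : odd_index j := negbNE ev.
have := admissible_odd (adm _ jD) od tj; rewrite in_setD => /andP[/negP[]].
rewrite eq_f imset_f // inE lt_jj' tj' andbT; apply: negbNE.
by rewrite -/(even_index j') eq_ev.
Qed.

Lemma card_davail i :
  (forall j, (j < i)%N -> even_index j -> admissible t f j) ->
  #|davail t f i| = hgt t i.
Proof.
move=> adm; have admE j : j \in dpos t i -> admissible t f j.
  by rewrite inE => /and3P[? ? _]; apply: adm.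
rewrite cardsD (setIidPr _) ?(card_in_imset (admissible_inj admE)) //.
apply/subsetP => _ /imsetP[j jE ->]; move: (jE); rewrite inE => /and3P[ji ev tj].
have /davailP[lt_f tf] := admissible_even (admE _ jE) ev tj.
by rewrite inE tf eqxx andbT (ltn_trans lt_f).
Qed.

Lemma card_uavail i :
  (forall j, (i < j)%N -> odd_index j -> admissible t f j) ->
  #|uavail t f i| = (#|uvals t i| - #|upos t i|)%N.
Proof.
move=> adm; have admO j : j \in upos t i -> admissible t f j.
  by rewrite inE => /and3P[? ? _]; apply: adm.
rewrite cardsD (setIidPr _) ?(card_in_imset (admissible_inj admO)) //.
apply/subsetP => _ /imsetP[j jO ->]; move: (jO); rewrite inE => /and3P[ji od tj].
have /uavailP[lt_f tf] := admissible_odd (admO _ jO) od tj.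
by rewrite inE tf eqxx andbT (ltn_trans ji).
Qed.

(** The inclusion is an equality by counting: the images are distinct and [balanced] equates the
    cardinalities. *)
Lemma dvals_image :
  balanced t -> (forall j, even_index j -> admissible t f j) ->
  f @: dpos t m = dvals t m.
Proof.
move=> /eqP bal adm; have admE j : j \in dpos t m -> admissible t f j.
  by rewrite inE => /and3P[_ ? _]; apply: adm.
apply/eqP; rewrite eqEcard bal (card_in_imset (admissible_inj admE)) leqnn andbT.
apply/subsetP => _ /imsetP[j jE ->]; move: (jE); rewrite inE => /and3P[ji ev tj].
have /davailP[lt_f tf] := admissible_even (admE _ jE) ev tj.
by rewrite inE tf eqxx andbT (ltn_trans lt_f).
Qed.

(* At a cycle valley [i], once all the even indices and the odd indices above
   [i] have their values, the available values are the starting points of the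
   paths in [{j | i <= j}]. *)
Lemma uavail_valley i : balanced t -> odd_index i -> nth None t i = Some true ->
  (forall j, even_index j || (i < j)%N -> admissible t f j) ->
  uavail t f i = (i |: [set j : 'I_m | (i < j)%N]) :\: f @: [set j : 'I_m | (i < j)%N].
Proof.
move=> bal od ti adm; apply/setP => k; rewrite !in_setD in_setU1 [k \in uvals t i]inE.
apply/andP/andP => [[kU]|[kA]].
  move=> /andP[ik /eqP tk]; split; last by rewrite inE ik orbT.
  apply: contra kU => /imsetP[j]; rewrite inE => ij eq_k.
  have := admissible_shape (adm j _); rewrite ij orbT -eq_k tk => /(_ isT).
  case: eqP => // /eqP tj [] ev; apply/imsetP; exists j => //.
  by rewrite inE ij tj andbT; apply: negbNE; rewrite -/(even_index j) -ev.
rewrite inE => ki; case tk: (nth None t k) => [[]|].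
(* An entry [Some true] at [k] makes it the image of an even index above [k], hence above [i], which
   is excluded. *)
- have := dvals_image bal (fun j ev => adm j (introT orP (or_introl ev))).
  move/setP/(_ k); rewrite [RHS]inE ltn_ord tk eqxx => /imsetP[j].
  rewrite inE => /and3P[_ ev tj] eq_k; case/negP: kA; apply/imsetP; exists j => //.
  have /davailP[] := admissible_even (adm j (introT orP (or_introl ev))) ev tj.
  rewrite -eq_k inE => kj _; apply: leq_ltn_trans kj.
  by case/orP: ki => [/eqP -> | ik]; [exact: leqnn | exact: ltnW ik].
- have ik : (i < k)%N by case/orP: ki tk => [/eqP ->|//]; rewrite ti.
  split; last by rewrite ik.
  apply: contra kA => /imsetP[j]; rewrite inE => /and3P[ij _ _] ->.
  by rewrite imset_f // inE.
- have ik : (i < k)%N by case/orP: ki tk => [/eqP ->|//]; rewrite ti.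
  have adm_k : admissible t f k by apply: adm; rewrite ik orbT.
  case/negP: kA; rewrite -{1}(admissible_fix adm_k tk) imset_f // inE //.
Qed.

End Admissible.

End Shapes.

(** * The weight of a shape *)

(** If one orbit of [i] stays at or above [i], the other function follows the same orbit. Thus the
    smaller odd indices, whose values come later, do not matter. *)
Lemma cycle_least_ext (m : nat) (f g : {ffun 'I_m -> 'I_m}) (i : 'I_m) :
  (forall j : 'I_m, (i <= j)%N -> f j = g j) -> cycle_least f i = cycle_least g i.
Proof.
have imp (f' g' : {ffun 'I_m -> 'I_m}) :
    (forall j : 'I_m, (i <= j)%N -> f' j = g' j) ->
    cycle_least f' i -> cycle_least g' i.
  move=> fg /forallP least; apply/forallP => j; apply/implyP => /iter_findex <-.
  have itE n : iter n g' i = iter n f' i.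
    elim: n => // n IH; rewrite !iterS IH fg //.
    exact: (implyP (least _) (fconnect_iter _ _ _)).
  by rewrite itE; apply: (implyP (least _) (fconnect_iter _ _ _)).
move=> fg; apply/idP/idP; apply: imp => // j ij; exact/esym/fg.
Qed.

Section Weights.

Variables (R : comNzRingType) (x1 x2 y1 y2 u1 u2 v1 v2 we wo ze zo : R).

(** With [od] the parity of the index, [Some true] is a cycle valley (odd) or double fall (even),
    and [Some false] a double rise (odd) or peak (even). A fixed point is a record-antirecord
    exactly when no arc passes over it, that is at height 0. *)
Definition step_weight (od : bool) (h : nat) (s : option bool) : R :=
  match s, od with
  | None, true => if h == 0%N then zo else wo
  | None, false => if h == 0%N then ze else we
  | Some true, true => lin y1 v1 h
  | Some false, true => lin y2 v2 h
  | Some true, false => lin x2 u2 h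
  | Some false, false => lin x1 u1 h
  end.

Section FixedShape.

Variable m : nat.
Implicit Types (t : seq (option bool)) (f g : {ffun 'I_m -> 'I_m}) (i j k : 'I_m).

(** Inadmissible choices get weight 0, so that sums can range over all functions. *)
Definition choice_weight t i f : R :=
  if admissible t f i then
    match nth None t i, odd_index i with
    | None, true => if uavail t f i == set0 then zo else wo
    | None, false => if davail t f i == set0 then ze else we
    | Some true, true => if cycle_least f i then y1 else v1
    | Some false, true => if [forall k in uavail t f i, (k <= f i)%N] then y2 else v2
    | Some true, false => if [forall k in davail t f i, (f i <= k)%N] then x2 else u2
    | Some false, false => if [forall k in davail t f i, (f i <= k)%N] then x1 else u1
    end
  else 0.

(** The height is taken before an even index but after an odd one, where [hgt_dual] counts the
    available values. *)
Definition shape_weight t i : R :=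
  step_weight (odd_index i) (hgt m t (odd_index i + i)) (nth None t i).

(** The offset [m] places all odd indices after the even ones. *)
Let rk j := if odd_index j then (m + (m - j))%N else j : nat.

Let rk_inj : injective rk.
Proof.
move=> i j; rewrite /rk; have := ltn_ord i; have := ltn_ord j.
by case: (odd_index i); case: (odd_index j) => *; apply: val_inj => /=; lia.
Qed.

Let choice_weight_ext t i f g :
  (forall j, (rk j <= rk i)%N -> f j = g j) ->
  choice_weight t i f = choice_weight t i g.
Proof.
move=> fg; rewrite /choice_weight /admissible -(fg i (leqnn _)).
case: (boolP (odd_index i)) => od.
  rewrite (@uavail_ext m t f g i) => [|j ij odj]; last first.
    by apply: fg; rewrite /rk od odj; lia.
  rewrite (@cycle_least_ext m f g i) // => j ij; apply: fg; rewrite /rk od.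
  by have := ltn_ord j; case: ifP => _; lia.
rewrite (@davail_ext m t f g i) // => j ji evj.
by apply: fg; rewrite /rk (negbTE od) (negbTE (evj : ~~ odd_index j)) ltnW.
Qed.

Let choice_weight_neq0 t i f : choice_weight t i f != 0 -> admissible t f i.
Proof. by rewrite /choice_weight; case: ifP; rewrite ?eqxx. Qed.

Let sum_choice_fix t i f a : nth None t i = None ->
  (forall x, choice_weight t i (upd f i x) = if x == i then a else 0) ->
  \sum_x choice_weight t i (upd f i x) = a.
Proof.
by move=> ti wE; rewrite (eq_bigr _ (fun x _ => wE x)) -big_mkcond big_pred1_eq.
Qed.

Let sum_choice_step t i f (S : {set 'I_m}) (P : pred 'I_m) a b :
  (forall x, choice_weight t i (upd f i x) =
     if x \in S then (if P x then a else b) else 0) ->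
  #|[set x in S | P x]| = (S != set0) ->
  \sum_x choice_weight t i (upd f i x) = lin a b #|S|.
Proof.
move=> wE card1; rewrite (eq_bigr _ (fun x _ => wE x)) -big_mkcond.
exact: sum_one_special.
Qed.

Lemma davail_upd t f i x : davail t (upd f i x) i = davail t f i.
Proof.
by apply: davail_ext => j ji _; rewrite updN //; apply: contraTneq ji => ->; rewrite ltnn.
Qed.

Lemma uavail_upd t f i x : uavail t (upd f i x) i = uavail t f i.
Proof.
by apply: uavail_ext => j ji _; rewrite updN //; apply: contraTneq ji => ->; rewrite ltnn.
Qed.

Lemma sum_choice_weights t : balanced m t ->
  \sum_f \prod_i choice_weight t i f = \prod_i shape_weight t i.
Proof.
move=> bal; apply: (sum_sequential_choices rk_inj) => [|i f wn0].
  exact: choice_weight_ext.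
have adm j : (rk j < rk i)%N -> admissible t f j.
  by move=> /wn0/choice_weight_neq0.
rewrite /shape_weight; case: (boolP (odd_index i)) => od; last first.
  rewrite add0n -(@card_davail m t f i) => [|j ji evj]; last first.
    by apply: adm; rewrite /rk (negbTE od) (negbTE (evj : ~~ odd_index j)).
  case ti: (nth None t i) => [b|] /=; last first.
    apply: sum_choice_fix => // x; rewrite /choice_weight /admissible ti /= updE.
    by rewrite (negbTE od) davail_upd cards_eq0.
  case: b ti => ti; apply: sum_choice_step (card_least _) => x;
    by rewrite /choice_weight /admissible ti /= (negbTE od) updE davail_upd.
rewrite add1n -hgt_dual // -(@card_uavail m t f i) => [|j ji odj]; last first.
  by apply: adm; rewrite /rk od odj; have := ltn_ord j; lia.
case ti: (nth None t i) => [[]|] /=; last first.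
- apply: sum_choice_fix => // x; rewrite /choice_weight /admissible ti /= updE.
  by rewrite od uavail_upd cards_eq0.
- apply: sum_choice_step (card_greatest _) => x;
    by rewrite /choice_weight /admissible ti /= od updE uavail_upd.
(* At a cycle valley the special value is not an extreme one but the one that closes a cycle within
   the indices at or above [i]. *)
apply: (sum_choice_step (P := fun x => cycle_least (upd f i x) i)) => [x|].
  by rewrite /choice_weight /admissible ti /= od updE uavail_upd.
have admA j : even_index j || (i < j)%N -> admissible t f j.
  move=> ev_ij; apply: adm; rewrite /rk od; have := ltn_ord j; have := ltn_ord i.
  by move: ev_ij; rewrite /even_index -/(odd_index j); case: (odd_index j) => /=; lia.
have uE := uavail_valley bal od ti admA.
set A := [set j : 'I_m | (i < j)%N] in uE.
have iA : i \notin A by rewrite inE ltnn.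
have injA : {in A &, injective f}.
  by apply: (@admissible_inj m t f) => j; rewrite inE => ij; apply: admA; rewrite ij orbT.
have card1 : #|[set x in uavail t f i | cycle_least (upd f i x) i]| = 1%N.
  rewrite -(card_closing_choices iA injA) -uE; apply: eq_card => x; rewrite !inE.
  congr (_ && _); apply: eq_forallb => j; congr (_ ==> _).
  by rewrite !inE leq_eqVlt eq_sym.
rewrite card1; suff -> : uavail t f i != set0 by [].
rewrite -card_gt0 -[X in (X <= _)%N]card1; apply: subset_leq_card.
by apply/subsetP => x; rewrite inE => /andP[].
Qed.

End FixedShape.

End Weights.

(** * The shape of a permutation *)

Section PermutationShape.

Variables (m : nat) (s : {perm 'I_m}).
Implicit Types i j k : 'I_m.

Definition perm_shape : m.-tuple (option bool) :=
  [tuple if s k == k then None else Some (k < (s^-1)%g k)%N | k < m].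

Lemma perm_shapeE k : nth None perm_shape k = if s k == k then None else Some (k < (s^-1)%g k)%N.
Proof. by rewrite -(tnth_nth None perm_shape k) tnth_mktuple. Qed.

Lemma perm_stable (S : {set 'I_m}) j : s @: S \subset S -> (s j \in S) = (j \in S).
Proof.
move=> sub; have eqS : s @: S = S.
  by apply/eqP; rewrite eqEcard sub card_imset ?leqnn //; apply: perm_inj.
by rewrite -{1}eqS mem_imset //; apply: perm_inj.
Qed.

(** At a fixed record the smaller indices are stable under [s], hence so are the larger ones; the
    converse is symmetric. *)
Lemma record_fixpt i : s i = i -> record s i = antirecord s i.
Proof.
move=> fix_i.
apply/forallP/forallP => H j; apply/implyP => ij.
  have stable : s @: [set k : 'I_m | (k < i)%N] \subset [set k : 'I_m | (k < i)%N].
    apply/subsetP => _ /imsetP[k + ->]; rewrite !inE => ki.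
    by have := implyP (H k) ki; rewrite fix_i.
  have := perm_stable j stable; rewrite !inE (ltnNge j) (ltnW ij) /=.
  move/negbT; rewrite -leqNgt leq_eqVlt fix_i => /orP[/eqP/val_inj eq_i|//].
  by move: ij; rewrite -(perm_inj (etrans fix_i eq_i)) ltnn.
have stable : s @: [set k : 'I_m | (i < k)%N] \subset [set k : 'I_m | (i < k)%N].
  apply/subsetP => _ /imsetP[k + ->]; rewrite !inE => ki.
  by have := implyP (H k) ki; rewrite fix_i.
have := perm_stable j stable; rewrite !inE (ltnNge i j) (ltnW ij) /=.
move/negbT; rewrite -leqNgt leq_eqVlt fix_i => /orP[/eqP/val_inj eq_i|//].
by move: ij; rewrite (perm_inj (etrans eq_i (esym fix_i))) ltnn.
Qed.

(** Pigeonhole: the indices up to [i] are mapped injectively to values up to [s i]. *)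
Lemma record_leq i : record s i -> (i <= s i)%N.
Proof.
move=> /forallP rec; rewrite leqNgt; apply/negP => lt_i.
have : s @: [set j : 'I_m | (j <= i)%N] \subset [set j : 'I_m | (j <= s i)%N].
  apply/subsetP => _ /imsetP[j + ->]; rewrite !inE leq_eqVlt => /orP[/eqP/val_inj ->//|ji].
  by apply/ltnW/(implyP (rec j)).
move/subset_leq_card; rewrite card_imset; last exact: perm_inj.
rewrite leqNgt => /negP[]; apply/proper_card/properP; split.
  by apply/subsetP => j; rewrite !inE => /leq_trans; apply; apply: ltnW.
by exists i; rewrite inE // -ltnNge.
Qed.

Lemma antirecord_geq i : antirecord s i -> (s i <= i)%N.
Proof.
move=> /forallP rec; rewrite leqNgt; apply/negP => lt_i.
have : s @: [set j : 'I_m | (i <= j)%N] \subset [set j : 'I_m | (s i <= j)%N].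
  apply/subsetP => _ /imsetP[j + ->]; rewrite !inE leq_eqVlt => /orP[/eqP/val_inj <-//|ji].
  by apply/ltnW/(implyP (rec j)).
move/subset_leq_card; rewrite card_imset; last exact: perm_inj.
rewrite leqNgt => /negP[]; apply/proper_card/properP; split.
  by apply/subsetP => j; rewrite !inE; apply: leq_trans (ltnW lt_i).
by exists i; rewrite inE // -ltnNge.
Qed.

Definition perm_ffun : {ffun 'I_m -> 'I_m} := [ffun k => s k].

Lemma cycle_least_perm i : cycle_least perm_ffun i = cycle_min s i.
Proof.
have itE n : iter n perm_ffun i = (s ^+ n)%g i.
  by rewrite permX; apply: eq_iter => k; rewrite ffunE.
apply: eq_forallb => j; congr (_ ==> _); apply/idP/porbitP => [/iter_findex <-|[n ->]].
  by exists (findex perm_ffun i j); rewrite itE.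
by rewrite -itE fconnect_iter.
Qed.

Hypothesis Ds : D_permutation s.

Lemma Dperm_odd i : odd_index i -> (i <= s i)%N.
Proof. by move=> od; have /forallP/(_ i) := Ds; rewrite od. Qed.

Lemma Dperm_even i : ~~ odd_index i -> (s i <= i)%N.
Proof. by move=> ev; have /forallP/(_ i) := Ds; rewrite (negbTE ev). Qed.

Lemma perm_neq i : s i != i -> (s i : nat) != i.
Proof. by apply: contraNneq => /val_inj ->. Qed.

Lemma nth_shape_eq0 k : (nth None perm_shape k == None) = (s k == k).
Proof. by rewrite perm_shapeE; case: (s k == k). Qed.

(** A descending arc must start at an even index, so a value below [i] is still free exactly when
    its preimage is at or above [i]. *)
Lemma davail_perm i k : (k \in davail perm_shape perm_ffun i) = (k < i <= (s^-1)%g k)%N.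
Proof.
rewrite !inE perm_shapeE; set j := (s^-1)%g k.
have sj : s j = k by rewrite permKV.
case: (ltnP k i) => ki; rewrite ?andbF //=.
have -> : (k \in perm_ffun @: dpos m perm_shape i) = [&& (j < i)%N, ~~ odd_index j & s j != j].
  apply/imsetP/idP => [[l]|H].
    rewrite inE nth_shape_eq0 ffunE => + eq_k.
    by rewrite [j](_ : _ = l) // /j eq_k permK.
  by exists j; rewrite ?ffunE // inE nth_shape_eq0.
have -> : (s k == k) = (s j == j).
  rewrite sj; apply/eqP/eqP => [fk|eq_k]; first by apply: (@perm_inj _ s); rewrite sj fk.
  by rewrite {1}eq_k sj.
case: eqVneq => [fj|]; rewrite ?andbF //=.
  by apply/esym/negbTE; rewrite -ltnNge -fj sj.
move=> /perm_neq nj; rewrite (_ : (Some _ == Some true) = (k < j)%N); last by case: (_ < _)%N.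
rewrite sj in nj; case: (boolP (odd_index j)) => od; rewrite ?andbF ?andbT /=.
  by have := Dperm_odd od; rewrite sj; lia.
by have := Dperm_even od; rewrite sj; lia.
Qed.

Lemma uavail_perm i k : (k \in uavail perm_shape perm_ffun i) = ((s^-1)%g k <= i < k)%N.
Proof.
rewrite !inE perm_shapeE; set j := (s^-1)%g k.
have sj : s j = k by rewrite permKV.
case: (ltnP i k) => ki; rewrite ?andbF //=.
have -> : (k \in perm_ffun @: upos m perm_shape i) = [&& (i < j)%N, odd_index j & s j != j].
  apply/imsetP/idP => [[l]|H].
    rewrite inE nth_shape_eq0 ffunE => + eq_k.
    by rewrite [j](_ : _ = l) // /j eq_k permK.
  by exists j; rewrite ?ffunE // inE nth_shape_eq0.
have -> : (s k == k) = (s j == j).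
  rewrite sj; apply/eqP/eqP => [fk|eq_k]; first by apply: (@perm_inj _ s); rewrite sj fk.
  by rewrite {1}eq_k sj.
case: eqVneq => [fj|]; rewrite ?andbF ?andbT //=.
  by apply/esym/negbTE; rewrite -ltnNge -fj sj.
move=> /perm_neq nj; rewrite (_ : (Some _ == Some false) = ~~ (k < j)%N); last by case: (_ < _)%N.
rewrite sj in nj; case: (boolP (odd_index j)) => od; rewrite ?andbF ?andbT /=.
  by have := Dperm_odd od; rewrite sj; lia.
by have := Dperm_even od; rewrite sj; lia.
Qed.

Lemma admissible_perm i : admissible perm_shape perm_ffun i.
Proof.
rewrite /admissible nth_shape_eq0 ffunE; case: eqVneq => // /perm_neq ni.
rewrite davail_perm uavail_perm permK leqnn andbT.
case: (boolP (odd_index i)) => od; first by have := Dperm_odd od; lia.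
by have := Dperm_even od; lia.
Qed.

Lemma balanced_shape : balanced m perm_shape.
Proof.
rewrite /balanced; suff -> : dvals m perm_shape m = s @: dpos m perm_shape m.
  by rewrite card_imset //; apply: perm_inj.
apply/setP => k; rewrite -{2}(permKV s k) mem_imset; last exact: perm_inj.
have := admissible_perm ((s^-1)%g k); set j := (s^-1)%g k => adm.
have sj : s j = k by rewrite permKV.
have := admissible_shape adm; rewrite ffunE sj !inE !ltn_ord /= => ->.
by case: (nth _ _ j) => [b|]; rewrite ?andbF //= andbT; case: (even_index j).
Qed.

(** As [s i < i], an index [j > i] can violate the antirecord condition only with [s j < i], and
    such an [s j] is an available value at [i]. *)
Lemma antirecord_least i : s i != i -> ~~ odd_index i ->
  antirecord s i = [forall k in davail perm_shape perm_ffun i, (perm_ffun i <= k)%N].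
Proof.
move=> /perm_neq ni /Dperm_even le_i; rewrite ffunE.
apply/forallP/forallP => H j; apply/implyP; last first.
  move=> ij; rewrite ltnNge; apply/negP => ji.
  have := implyP (H (s j)); rewrite davail_perm permK (ltnW ij) andbT.
  rewrite (leq_ltn_trans ji) ?ltn_neqAle ?ni // => /(_ isT) ij'.
  have /val_inj/perm_inj eq_ij : (s i : nat) = s j by apply/eqP; rewrite eqn_leq ij'.
  by rewrite eq_ij ltnn in ij.
rewrite davail_perm => /andP[ji]; rewrite leq_eqVlt => /orP[/eqP/val_inj ->|lt_i].
  by rewrite permKV.
by apply/ltnW; have := implyP (H _) lt_i; rewrite permKV.
Qed.

Lemma record_greatest i : s i != i -> odd_index i ->
  record s i = [forall k in uavail perm_shape perm_ffun i, (k <= perm_ffun i)%N].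
Proof.
move=> /perm_neq ni /Dperm_odd le_i; rewrite ffunE.
apply/forallP/forallP => H j; apply/implyP; last first.
  move=> ij; rewrite ltnNge; apply/negP => ji.
  have := implyP (H (s j)); rewrite uavail_perm permK (ltnW ij) /=.
  rewrite (leq_trans _ ji) ?ltn_neqAle 1?eq_sym ?ni // => /(_ isT) ij'.
  have /val_inj/perm_inj eq_ij : (s i : nat) = s j by apply/eqP; rewrite eqn_leq ij' ji.
  by rewrite eq_ij ltnn in ij.
rewrite uavail_perm => /andP[+ ji]; rewrite leq_eqVlt => /orP[/eqP/val_inj <-|lt_i].
  by rewrite permKV.
by apply/ltnW; have := implyP (H _) lt_i; rewrite permKV.
Qed.

Lemma antirecord_fixpt i : s i = i ->
  antirecord s i = (davail perm_shape perm_ffun i == set0).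
Proof.
move=> fi; apply/forallP/eqP => [H|H j].
  apply/setP => k; rewrite davail_perm inE; apply/negbTE/andP => -[ki].
  rewrite leq_eqVlt => /orP[/eqP/val_inj eq_i|lt_i].
    by move: ki; rewrite -[k](permKV s) -eq_i fi ltnn.
  by have := implyP (H _) lt_i; rewrite permKV fi ltnNge ltnW.
apply/implyP => ij; rewrite ltnNge fi; apply/negP => ji.
have := davail_perm i (s j); rewrite H inE permK (ltnW ij) andbT => /esym/negbT.
rewrite -leqNgt => ij'; have/val_inj eq_i : (s j : nat) = i by apply/eqP; rewrite eqn_leq ji.
by move: ij; rewrite -(perm_inj (etrans eq_i (esym fi))) ltnn.
Qed.

Lemma record_uavail_fixpt i : s i = i ->
  record s i = (uavail perm_shape perm_ffun i == set0).
Proof.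
move=> fi; apply/forallP/eqP => [H|H j].
  apply/setP => k; rewrite uavail_perm inE; apply/negbTE/andP => -[+ ki].
  rewrite leq_eqVlt => /orP[/eqP/val_inj eq_i|lt_i].
    by move: ki; rewrite -[k](permKV s) eq_i fi ltnn.
  by have := implyP (H _) lt_i; rewrite permKV fi ltnNge ltnW.
apply/implyP => ij; rewrite ltnNge fi; apply/negP => ji.
have := uavail_perm i (s j); rewrite H inE permK (ltnW ij) /= => /esym/negbT.
rewrite -leqNgt => ij'; have/val_inj eq_i : (s j : nat) = i by apply/eqP; rewrite eqn_leq ij' ji.
by move: ij; rewrite (perm_inj (etrans eq_i (esym fi))) ltnn.
Qed.

End PermutationShape.

Lemma perm_of_admissible (m : nat) (t : m.-tuple (option bool))
    (f : {ffun 'I_m -> 'I_m}) :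
  (forall j, admissible t f j) ->
  exists s : {perm 'I_m}, [/\ D_permutation s, perm_shape s = t & perm_ffun s = f].
Proof.
move=> adm; have f_inj : injective f.
  by move=> i j; apply: (@admissible_inj m t f setT) => // k _; apply: adm.
have sE j : perm f_inj j = f j by rewrite permE.
exists (perm f_inj); split; last by apply/ffunP => j; rewrite ffunE sE.
- apply/forallP => j; rewrite sE.
  have [tj|tj] := eqVneq (nth None t j) None.
    by rewrite (admissible_fix (adm j) tj) leqnn if_same.
  case: (boolP (odd_index j)) => od.
    by have /uavailP[/ltnW] := admissible_odd (adm j) od tj.
  by have /davailP[/ltnW] := admissible_even (adm j) od tj.
- apply: eq_from_tnth => k; rewrite tnth_mktuple.
  rewrite -[k](permKV (perm f_inj)); set j := ((perm f_inj)^-1)%g k.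
  rewrite permK (inj_eq perm_inj) (tnth_nth None) sE (admissible_shape (adm j)).
  have [tj|tj] := eqVneq (nth None t j) None.
    by rewrite (admissible_fix (adm j) tj) eqxx.
  case: (boolP (odd_index j)) => od.
    have /uavailP[lt_f _] := admissible_odd (adm j) od tj.
    rewrite ifN; last by apply: contraTneq lt_f => ->; rewrite ltnn.
    by congr Some; rewrite /even_index -/(odd_index j) od ltnNge ltnW.
  have /davailP[lt_f _] := admissible_even (adm j) od tj.
  rewrite ifN; last by apply: contraTneq lt_f => ->; rewrite ltnn.
  by congr Some; rewrite /even_index -/(odd_index j) od lt_f.
Qed.

(** * The weight of a permutation *)

Lemma expr_card_set (R : pzSemiRingType) (T : finType) (P : pred T) (x : R) :
  x ^+ #|[set i | P i]| = \prod_i (if P i then x else 1).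
Proof.
by rewrite -prodr_const big_mkcond; apply: eq_bigr => i _; rewrite inE.
Qed.

Section PermutationWeight.

Variables (R : comNzRingType) (x1 x2 y1 y2 u1 u2 v1 v2 we wo ze zo : R) (m : nat).

(** The summand of [Ptilde], over any commutative ring and for any size [m]. *)
Definition perm_weight (s : {perm 'I_m}) : R :=
  x1 ^+ eareccpeak s * x2 ^+ eareccdfall s *
  y1 ^+ minval s * y2 ^+ ereccdrise s *
  u1 ^+ nrcpeak s * u2 ^+ nrcdfall s *
  v1 ^+ nminval s * v2 ^+ nrcdrise s *
  we ^+ evennrfix s * wo ^+ oddnrfix s *
  ze ^+ evenrar s * zo ^+ oddrar s.

Let choice_weight' := (choice_weight x1 x2 y1 y2 u1 u2 v1 v2 we wo ze zo).

(** Each index is counted by exactly one of the twelve statistics, so the comparison is made index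
    by index. *)
Lemma perm_weightE s : D_permutation s ->
  perm_weight s = \prod_i choice_weight' (perm_shape s) i (perm_ffun s).
Proof.
move=> Ds; rewrite /perm_weight !expr_card_set -!big_split; apply: eq_bigr => i _ /=.
rewrite /choice_weight' /choice_weight admissible_perm // perm_shapeE cycle_least_perm.
rewrite /earec /erec /rar /nrar /cpeak /cdfall /cdrise /cvalley /fixpt.
rewrite /even_index -/(odd_index i).
have [fi|ni] := eqVneq (s i) i.
  rewrite -antirecord_fixpt // -record_uavail_fixpt // -record_fixpt // fi ltnn.
  rewrite !andbF !andbb ?andbT /=; case: (odd_index i); case: (record s i);
    by rewrite /= ?mulr1 ?mul1r.
have ni' := perm_neq ni.
have nV : ((s^-1)%g i : nat) != i.
  apply: contraNneq ni => /val_inj eq_i.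
  by rewrite -[X in s X]eq_i permKV.
case: (boolP (odd_index i)) => od.
  have lt_i : (i < s i)%N by have := Dperm_odd Ds od; lia.
  have -> : antirecord s i = false.
    by apply: contraTF lt_i => /antirecord_geq; rewrite -leqNgt.
  have ge_i : (s i < i)%N = false by rewrite ltnNge ltnW.
  rewrite -(record_greatest Ds ni od) lt_i ge_i /= ?andbF ?andbT /=.
  by case: ltngtP nV => // _ _; case: (record s i); case: (cycle_min s i);
     rewrite /= ?mulr1 ?mul1r.
have lt_i : (s i < i)%N by have := Dperm_even Ds od; lia.
have -> : record s i = false.
  by apply: contraTF lt_i => /record_leq; rewrite -leqNgt.
have ge_i : (i < s i)%N = false by rewrite ltnNge ltnW.
rewrite -(antirecord_least Ds ni od) lt_i ge_i /= ?andbF ?andbT /=.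
by case: ltngtP nV => // _ _; case: (antirecord s i); rewrite /= ?mulr1 ?mul1r.
Qed.

Lemma choice_weight_perm (t : m.-tuple (option bool)) (f : {ffun 'I_m -> 'I_m}) :
  \prod_i choice_weight' t i f != 0 ->
  exists s : {perm 'I_m}, [/\ D_permutation s, perm_shape s = t & perm_ffun s = f].
Proof.
move=> wn0; apply: perm_of_admissible => j; apply: contraNT wn0 => nadm.
by rewrite (bigD1 j) //= /choice_weight' /choice_weight (negbTE nadm) mul0r.
Qed.

Lemma sum_perm_weight :
  \sum_(s : {perm 'I_m} | D_permutation s) perm_weight s
  = \sum_(t : m.-tuple (option bool) | balanced m t)
      \prod_(i < m) shape_weight x1 x2 y1 y2 u1 u2 v1 v2 we wo ze zo t i.
Proof.
rewrite (partition_big (@perm_shape m) (balanced m)) => [|s]; last exact: balanced_shape.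
apply: eq_bigr => t bal; rewrite -sum_choice_weights //.
pose D := [set s : {perm 'I_m} | D_permutation s && (perm_shape s == t)].
have ffun_inj : {in D &, injective (@perm_ffun m)}.
  move=> s s' _ _ /ffunP eq_s; apply/permP => i.
  by have := eq_s i; rewrite !ffunE.
transitivity (\sum_(f in @perm_ffun m @: D) \prod_i choice_weight' t i f).
  rewrite big_imset //=; apply: eq_big => [s|s /andP[Ds /eqP <-]]; first by rewrite inE.
  exact: perm_weightE.
(* Functions that do not come from a D-permutation of shape [t] have an inadmissible value, hence
   weight 0. *)
rewrite big_mkcond; apply: eq_bigr => f _; case: ifPn => // fD.
apply/eqP; rewrite eq_sym; apply: contraNT fD => /choice_weight_perm[s [Ds st <-]].
by apply: imset_f; rewrite inE Ds st eqxx.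
Qed.

End PermutationWeight.

(** * Lattice paths *)

Lemma big_tuple_rcons (R : nmodType) (T : finType) (m : nat) (P : pred (seq T))
    (F : seq T -> R) :
  \sum_(t : m.+1.-tuple T | P t) F t =
  \sum_x \sum_(t : m.-tuple T | P (rcons t x)) F (rcons t x).
Proof.
rewrite pair_big_dep /= (reindex (fun p : T * m.-tuple T => rcons_tuple p.2 p.1)) //=.
apply: onW_bij; apply: inj_card_bij => [[x t] [y t'] /= /(congr1 val) /= /rcons_inj|].
  by case=> /val_inj -> ->.
by rewrite card_prod !card_tuple expnS.
Qed.

Lemma big_option_bool (R : nmodType) (F : option bool -> R) :
  \sum_x F x = F None + F (Some true) + F (Some false).
Proof.
rewrite (bigD1 None) // (bigD1 (Some true)) // (bigD1 (Some false)) //= big_pred0.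
  by rewrite addr0 addrA.
by case=> [[]|].
Qed.

Section Paths.

Variables (R : comNzRingType) (x1 x2 y1 y2 u1 u2 v1 v2 we wo ze zo : R).
Implicit Types t : seq (option bool).

Let sw := step_weight x1 x2 y1 y2 u1 u2 v1 v2 we wo ze zo.

(** Counts over sequences rather than ordinals of a fixed bound, so that a path can be extended by
    [rcons]. In [downs], [odd j] is the parity of an even index, the index being [j.+1]. *)
Definition ups t p := (\sum_(j < p) (nth None t j == Some true))%N.
Definition downs t p := (\sum_(j < p) (odd j && (nth None t j != None)))%N.

Lemma card_dvals m t p : (p <= m)%N -> #|dvals m t p| = ups t p.
Proof.
move=> pm; rewrite card_set_sum /ups.
rewrite (big_ord_widen _ (fun j => nat_of_bool (nth None t j == Some true)) pm).
by rewrite [RHS]big_mkcond; apply: eq_bigr => j _; case: (j < p)%N.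
Qed.

Lemma card_dpos m t p : (p <= m)%N -> #|dpos m t p| = downs t p.
Proof.
move=> pm; rewrite card_set_sum /downs.
rewrite (big_ord_widen _ (fun j => nat_of_bool (odd j && (nth None t j != None))) pm).
rewrite [RHS]big_mkcond; apply: eq_bigr => j _; rewrite /even_index /= negbK.
by case: (j < p)%N.
Qed.

Definition path_weight t i :=
  sw (~~ odd i) (ups t (~~ odd i + i) - downs t (~~ odd i + i)) (nth None t i).

Definition path_sum m h :=
  \sum_(t : m.-tuple (option bool) | ups t m == (downs t m + h)%N)
    \prod_(i < m) path_weight t i.

Lemma sum_shape_weight m :
  \sum_(t : m.-tuple (option bool) | balanced m t)
    \prod_(i < m) shape_weight x1 x2 y1 y2 u1 u2 v1 v2 we wo ze zo t i
  = path_sum m 0.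
Proof.
apply: eq_big => [t|t _]; first by rewrite /balanced card_dvals // card_dpos // addn0.
apply: eq_bigr => i _; rewrite /shape_weight /path_weight /hgt /odd_index /=.
have le_m : (~~ odd i + i <= m)%N by have := ltn_ord i; case: (odd i) => /=; lia.
by rewrite card_dvals // card_dpos.
Qed.

Lemma path_sum0 h : path_sum 0 h = (h == 0%N)%:R.
Proof.
rewrite /path_sum /ups /downs; under eq_bigl do rewrite !big_ord0 add0n eq_sym.
under eq_bigr do rewrite big_ord0.
case: (h == 0%N); last by rewrite big_pred0.
by rewrite (big_pred1 [tuple]) // => t; apply/esym/eqP; exact: tuple0.
Qed.

Lemma ups_rcons m (t : m.-tuple (option bool)) x p : (p <= m)%N ->
  ups (rcons t x) p = ups t p.
Proof.
move=> pm; apply: eq_bigr => j _.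
by rewrite nth_rcons size_tuple (leq_trans (ltn_ord j) pm).
Qed.

Lemma downs_rcons m (t : m.-tuple (option bool)) x p : (p <= m)%N ->
  downs (rcons t x) p = downs t p.
Proof.
move=> pm; apply: eq_bigr => j _.
by rewrite nth_rcons size_tuple (leq_trans (ltn_ord j) pm).
Qed.

Lemma ups_rconsS m (t : m.-tuple (option bool)) x :
  ups (rcons t x) m.+1 = (ups t m + (x == Some true))%N.
Proof.
rewrite /ups big_ord_recr /= -/(ups _ m) ups_rcons //.
by rewrite nth_rcons size_tuple ltnn eqxx.
Qed.

Lemma downs_rconsS m (t : m.-tuple (option bool)) x :
  downs (rcons t x) m.+1 = (downs t m + (odd m && (x != None)))%N.
Proof.
rewrite /downs big_ord_recr /= -/(downs _ m) downs_rcons //.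
by rewrite nth_rcons size_tuple ltnn eqxx.
Qed.

Lemma path_weight_rcons m (t : m.-tuple (option bool)) x i : (i < m)%N ->
  path_weight (rcons t x) i = path_weight t i.
Proof.
move=> im; have le_m : (~~ odd i + i <= m)%N by case: (odd i) => /=; lia.
by rewrite /path_weight ups_rcons // downs_rcons // nth_rcons size_tuple im.
Qed.

Lemma path_weight_last m (t : m.-tuple (option bool)) x :
  path_weight (rcons t x) m =
  sw (~~ odd m) (ups t m + (~~ odd m && (x == Some true)) - downs t m) x.
Proof.
rewrite /path_weight nth_rcons size_tuple ltnn eqxx.
case od: (odd m); first by rewrite ups_rcons // downs_rcons // addn0.
by rewrite ups_rconsS downs_rconsS od addn0.
Qed.

Lemma path_sumS m h :
  path_sum m.+1 h = \sum_x
    \sum_(t : m.-tuple (option bool) |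
          (ups t m + (x == Some true) == downs t m + (odd m && (x != None)) + h)%N)
      (\prod_(i < m) path_weight t i) *
      sw (~~ odd m) (ups t m + (~~ odd m && (x == Some true)) - downs t m) x.
Proof.
rewrite /path_sum (@big_tuple_rcons _ _ m (fun t => ups t m.+1 == (downs t m.+1 + h)%N)
  (fun t => \prod_(i < m.+1) path_weight t i)).
apply: eq_bigr => x _; apply: eq_big => [t|t _]; first by rewrite ups_rconsS downs_rconsS.
rewrite big_ord_recr /= path_weight_last; congr (_ * _).
by apply: eq_bigr => i _; rewrite path_weight_rcons.
Qed.

Lemma path_sum_term m h (P : pred (m.-tuple (option bool))) (F : m.-tuple (option bool) -> R) c :
  (forall t : m.-tuple _, P t = (ups t m == downs t m + h)%N) ->
  (forall t : m.-tuple _, (ups t m = downs t m + h)%N -> F t = c) ->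
  \sum_(t | P t) (\prod_(i < m) path_weight t i) * F t = c * path_sum m h.
Proof.
move=> PE FE; rewrite mulr_sumr; apply: eq_big => // t.
by rewrite PE => /eqP /FE ->; rewrite mulrC.
Qed.

(** Steps that keep the height: a fixed point or a double rise at an odd index, a fixed point or a
    double fall at an even index. *)
Definition level_odd h := sw true h None + sw true h (Some false).
Definition level_even h := sw false h None + sw false h (Some true).

Lemma path_sum_odd m h : ~~ odd m ->
  path_sum m.+1 h = level_odd h * path_sum m h
    + (if h is h'.+1 then lin y1 v1 h * path_sum m h' else 0).
Proof.
move=> ev; rewrite path_sumS big_option_bool (negbTE ev) /=.
rewrite (@path_sum_term m h _ _ (sw true h None)) => [|t|t ->]; first last.
- by rewrite addn0 addKn.
- by rewrite !addn0.
rewrite [X in _ + X](@path_sum_term m h _ _ (sw true h (Some false))) => [|t|t ->]; first last.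
- by rewrite addn0 addKn.
- by rewrite !addn0.
rewrite addrAC -mulrDl; congr (_ + _); case: h => [|h].
  (* A rise to height 0 would start below 0; its truncated height gives the factor [lin y1 v1 0],
     which is 0. *)
  rewrite big1 // => t; rewrite !addn0 => /eqP ->.
  by rewrite subnn /= mulr0.
apply: path_sum_term => t; first by rewrite addn0 addn1 addnS eqSS.
by move=> ->; rewrite -addnA addKn addn1.
Qed.

Lemma path_sum_even m h : odd m ->
  path_sum m.+1 h = level_even h * path_sum m h + lin x1 u1 h.+1 * path_sum m h.+1.
Proof.
move=> od; rewrite path_sumS big_option_bool od /=.
rewrite (@path_sum_term m h _ _ (sw false h None)) => [|t|t ->]; first last.
- by rewrite addn0 addKn.
- by rewrite !addn0.
rewrite [X in _ + X + _](@path_sum_term m h _ _ (sw false h (Some true))) => [|t|t ->]; first last.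
- by rewrite addn0 addKn.
- by rewrite addnAC eqn_add2r.
rewrite -mulrDl; congr (_ + _); apply: path_sum_term => t.
  by rewrite addn0 -addnA add1n.
by move=> ->; rewrite addn0 addKn.
Qed.

(** * Comparison of the paths with the continued fraction *)

Section TFraction.

Variables (alpha delta : nat -> R).
Hypothesis alpha_odd : forall k : nat, (1 <= k)%N ->
  alpha (2 * k - 1)%N = (x1 + (k - 1)%N%:R * u1) * (y1 + (k - 1)%N%:R * v1).
Hypothesis alpha_even : forall k : nat, (1 <= k)%N ->
  alpha (2 * k)%N = (x2 + (k - 1)%N%:R * u2 + we) * (y2 + (k - 1)%N%:R * v2 + wo).
Hypothesis delta_1 : delta 1%N = ze * zo.
Hypothesis delta_ge2 : forall n : nat, (2 <= n)%N -> delta n = 0.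

(** The coefficients of odd index pair a rise with the fall that matches it; those of even index
    pair two level steps at the same height. *)
Let alpha_peak h : alpha (2 * h).+1 = lin x1 u1 h.+1 * lin y1 v1 h.+1.
Proof.
have -> : ((2 * h).+1 = 2 * h.+1 - 1)%N by lia.
by rewrite alpha_odd // subn1.
Qed.

Let alpha_level h : alpha (2 * h).+2 = level_even h.+1 * level_odd h.+1.
Proof.
have -> : ((2 * h).+2 = 2 * h.+1)%N by lia.
by rewrite alpha_even // subn1 /level_even /level_odd /= addrC; ring.
Qed.

Let tail_prod_even N n h : ((2 * h).+1 < N)%N ->
  tail_prod alpha delta N (2 * h).+2 n = tail_prod alpha delta N (2 * h).+1 n
    + alpha (2 * h).+2 *
      (if (1 <= n)%N then tail_prod alpha delta N (2 * h).+3 (n - 1) else 0).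
Proof.
move=> hN; case: n => [|n]; first by rewrite mulr0 addr0 !tail_prod0 // ltnW.
by rewrite tail_prodS // delta_ge2 // mul0r addr0 subn1.
Qed.

(* The left-hand side counts the paths that end at height [h] by their last
   steps, the right-hand side the same paths by their last visits to the heights
   [0, ..., h - 1]. *)
Lemma path_sum_tail_prod N n h : ((2 * (n + h)).+1 <= N)%N ->
  path_sum (2 * n) h =
  (\prod_(j < h) (lin y1 v1 j.+1 * level_even j.+1)) *
  (if (h <= n)%N then tail_prod alpha delta N (2 * h).+1 (n - h) else 0).
Proof.
(* The bound on [N] depends on [n + h], so it passes from [n.+1], [h] to [n], [h.+1]. *)
elim: n h => [|n IH] h hN.
  rewrite muln0 path_sum0; case: h hN => [|h] hN; last by rewrite mulr0.
  by rewrite big_ord0 mul1r tail_prod0.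
have od : odd (2 * n).+1 by rewrite /= mul2n odd_double.
have ev : ~~ odd (2 * n) by rewrite mul2n odd_double.
have -> : (2 * n.+1 = (2 * n).+2)%N by lia.
rewrite (path_sum_even _ od) !(path_sum_odd _ ev) (IH h.+1); last by lia.
rewrite big_ord_recr /= (IH h); last by lia.
(* At height 0 the two level steps have weight [ze * zo], which is [delta 1]. *)
case: h hN => [|h] hN.
  rewrite big_ord0 !mul1r !subn0 addr0 tail_prodS; last by lia.
  rewrite delta_1 (_ : tail_prod _ _ _ 0 _ = 0) // add0r.
  rewrite (tail_prod_even n (h := 0)) ?alpha_level ?(alpha_peak 0); last by lia.
  by rewrite /level_even /level_odd /= !addr0 muln1 ?muln0; ring.
rewrite (IH h); last by lia.
rewrite big_ord_recr /= subSS ltnS.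
(* With [h.+1] the final height: the generic case, a height out of reach, and the extreme height,
   reached only by rising at every odd index. *)
case: (ltngtP h n) => [lt_hn|gt_hn|eq_hn].
- have [q eq_q] : exists q, (n - h = q.+1)%N by exists (n - h).-1; lia.
  rewrite eq_q (_ : (n - h.+1 = q)%N); last by lia.
  rewrite (_ : ((2 * h.+1).+1 = (2 * h).+3)%N); last by lia.
  rewrite (@tail_prodS _ _ _ _ (2 * h).+2); last by lia.
  rewrite delta_ge2 // mul0r addr0 tail_prod_even; last by lia.
  rewrite (_ : ((2 * h).+4 = (2 * h.+1).+2)%N); last by lia.
  rewrite tail_prod_even; last by lia.
  rewrite (_ : ((2 * h).+3 = (2 * h.+1).+1)%N); last by lia.
  rewrite (_ : (n - h.+2 = q - 1)%N); last by lia.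
  rewrite (_ : (h.+1 < n)%N = (1 <= q)%N); last by lia.
  rewrite (_ : ((2 * h.+2).+1 = (2 * h.+1).+3)%N); last by lia.
  rewrite !alpha_level alpha_peak !subn1 /=.
  by case: ifP => _; ring.
- rewrite (_ : (h.+1 < n)%N = false); last by lia.
  by rewrite !(mulr0, addr0).
- rewrite eq_hn (_ : (n.+1 < n)%N = false); last by lia.
  rewrite subnn !tail_prod0; [|lia..].
  by rewrite !(mulr0, mulr1, addr0, add0r); ring.
Qed.

Lemma path_sum_T_fraction : is_T_fraction alpha delta (fun n => path_sum (2 * n) 0).
Proof.
move=> n; exists (2 * n).+1 => N leN.
rewrite -tail_prod1; last by apply: leq_ltn_trans leN.
by rewrite (@path_sum_tail_prod N) ?addn0 // big_ord0 mul1r subn0.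
Qed.

End TFraction.

End Paths.

Theorem theorem4p1 (alpha delta : nat -> {mpoly int[12]})
  (alpha_odd : forall k : nat, (1 <= k)%N ->
     alpha (2 * k - 1)%N = (x1 + (k - 1)%N%:R * u1) * (y1 + (k - 1)%N%:R * v1))
  (alpha_even : forall k : nat, (1 <= k)%N ->
     alpha (2 * k)%N = (x2 + (k - 1)%N%:R * u2 + we)
                       * (y2 + (k - 1)%N%:R * v2 + wo))
  (delta_1 : delta 1%N = ze * zo)
  (delta_ge2 : forall n : nat, (2 <= n)%N -> delta n = 0) :
  is_T_fraction alpha delta Ptilde.
Proof.
move=> n.
have [N0 lim] := path_sum_T_fraction alpha_odd alpha_even delta_1 delta_ge2 n.
exists N0 => N /lim ->; rewrite -sum_shape_weight -sum_perm_weight.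
(* For [m] equal to [2 * n] the sum of [perm_weight] is [Ptilde n] by conversion. *)
by [].
Qed.
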